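(* Let $\varphi,\Phi\in\mathscr{L}\text{-}\mathscr{P}^+$, and let $\{B_k^{\varphi}(t)\}_{k=0}^\infty$ and $\{B_k^{\Phi}(s)\}_{k=0}^\infty$ be the associated sequences. Then the sequence $\{C_k^{\varphi,\Phi}(t,s)\}_{k=0}^\infty$ defined by $$C_k^{\varphi,\Phi}(t,s):=\sum_{j=0}^k\binom kj B_j^{\varphi}(t)\,B_{k-j}^{\Phi}(s)$$ is a multiplier sequence for all $(t,s)\in[0,1]\times[0,1]$.
   Context: For $\varphi(x)=\sum_{k=0}^\infty\frac{\gamma_k}{k!}x^k$ one sets $B_k^{\varphi}(t)=\sum_{j=0}^k\binom kj(1-t)^j\gamma_{k-j}t^{k-j}$ (with $0^0=1$); $B_k^{\Phi}(s)$ is defined in the same way from the Taylor coefficients of $\Phi$. A real entire function $\varphi(x)=\sum_{k=0}^\infty \frac{\gamma_k}{k!}x^k$ is said to be of type I in the Laguerre–Pólya class if $\varphi(x)$ or $\varphi(-x)$ can be written as $c x^m e^{\sigma x}\prod_{k=1}^{\omega}\left(1+\frac{x}{x_k}\right)$, where $c\in\mathbb{R}$, $m$ is a non-negative integer, $\sigma\ge 0$, $x_k>0$, $0\le\omega\le\infty$ and $\sum_{k=1}^{\omega}\frac1{x_k}<+\infty$. If in addition $\gamma_k\ge 0$ for all $k=0,1,2,\ldots$, we write $\varphi\in\mathscr{L}\text{-}\mathscr{P}^+$. A sequence of real numbers $\{\gamma_k\}_{k=0}^\infty$ is a multiplier sequence if the linear operator $T$ on real polynomials defined by $T[x^k]=\gamma_kx^k$,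 $k=0,1,2,\ldots$, has the property that $T[p]$ has no non-real zeros whenever the real polynomial $p$ has no non-real zeros (the zero polynomial is regarded as having no non-real zeros). *)

(* Defs.v *)
From HB Require Import structures.
From mathcomp Require Import all_boot all_order all_algebra.
From mathcomp Require Import all_classical all_reals all_analysis.
From mathcomp Require Export complex.

Set Implicit Arguments.
Unset Strict Implicit.
Unset Printing Implicit Defensive.

Import Order.TTheory GRing.Theory Num.Theory numFieldNormedType.Exports.

Local Open Scope ring_scope.
Local Open Scope classical_set_scope.
Local Open Scope complex_scope.

(* R[i] packaged as a numClosedFieldType, so that it inherits the topology
   of its norm *)
Definition Cplx (R : realType) : numClosedFieldType := R[i].

Section EntireFunctions.
Variable R : realType.
Local Notation C := (Cplx R).

Definition ofR (x : R) : C := x%:C.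

Definition cexp (z : C) : C :=
  let: a +i* b := z in (expR a * cos b) +i* (expR a * sin b).

Definition real_entire (phi : C -> C) (gamma : nat -> R) : Prop :=
  forall z : C, series (fun k => ofR (gamma k / k`!%:R) * z ^+ k) @ \oo --> phi z.

(* omega = Some N encodes a finite number N of factors, None encodes
   omega = +oo; the factors are numbered from 0 *)
Definition in_range (omega : option nat) (k : nat) : bool :=
  if omega is Some N then (k < N)%N else true.

(* psi(z) = c z^m e^(sigma z) prod_(k < omega) (1 + z / x_k).  Partial products
   and sums are restricted to the indices below omega, so they are eventually
   constant when omega is finite. *)
Definition LP_product_form (psi : C -> C) : Prop :=
  exists (c : R) (m : nat) (sigma : R) (omega : option nat) (x : nat -> R)
    (P : C -> C),
    [/\ 0 <= sigma,
        forall k, in_range omega k -> 0 < x k,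
        cvgn (fun n => \sum_(k < n | in_range omega k) (x k)^-1),
        forall z : C,
          (fun n => \prod_(k < n | in_range omega k) (1 + z / ofR (x k)))
            @ \oo --> P z &
        forall z : C, psi z = ofR c * z ^+ m * cexp (ofR sigma * z) * P z].

Definition LP_typeI (phi : C -> C) (gamma : nat -> R) : Prop :=
  real_entire phi gamma /\
  (LP_product_form phi \/ LP_product_form (fun z => phi (- z))).

(* gamma is determined by phi: gamma_k / k! are its Taylor coefficients at 0 *)
Definition LP_plus (phi : C -> C) (gamma : nat -> R) : Prop :=
  LP_typeI phi gamma /\ forall k, 0 <= gamma k.

End EntireFunctions.

Section MultiplierSequences.
Variable R : realType.

Definition only_real_zeros (p : {poly R}) : Prop :=
  p = 0 \/
  forall z : R[i], root (map_poly (real_complex R) p) z -> z \is Num.real.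

Definition diag_op (gamma : nat -> R) (p : {poly R}) : {poly R} :=
  \poly_(k < size p) (gamma k * p`_k).

Lemma coef_diag_op gamma p k : (diag_op gamma p)`_k = gamma k * p`_k.
Proof.
by rewrite coef_poly; case: ltnP => // ?; rewrite nth_default ?mulr0.
Qed.

(* diag_op gamma is the linear operator T with T[x^k] = gamma_k x^k *)
Lemma diag_op_is_linear gamma : linear (diag_op gamma).
Proof.
move=> a p q; apply/polyP => k.
by rewrite !(coefD, coefZ, coef_diag_op) mulrDr mulrCA.
Qed.

HB.instance Definition _ (gamma : nat -> R) :=
  GRing.isLinear.Build R {poly R} {poly R} _ (diag_op gamma)
    (diag_op_is_linear gamma).

Lemma diag_opXn gamma k : diag_op gamma 'X^k = gamma k *: 'X^k.
Proof.
apply/polyP => i; rewrite coef_diag_op coefZ coefXn.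
by case: eqP => [->|_]; rewrite ?mulr0.
Qed.

Definition multiplier_sequence (gamma : nat -> R) : Prop :=
  forall p : {poly R}, only_real_zeros p -> only_real_zeros (diag_op gamma p).

(* x ^+ 0 = 1 for every x, including 0 *)
Definition Bseq (gamma : nat -> R) (k : nat) (t : R) : R :=
  \sum_(j < k.+1)
    'C(k, j)%:R * (1 - t) ^+ j * gamma (k - j)%N * t ^+ (k - j).

Definition Cseq (gamma Gamma : nat -> R) (k : nat) (t s : R) : R :=
  \sum_(j < k.+1) 'C(k, j)%:R * Bseq gamma j t * Bseq Gamma (k - j) s.

End MultiplierSequences.

(* Main.v *)
Require Import Defs.
From mathcomp Require Import all_boot all_order all_algebra.
From mathcomp Require Import all_classical all_reals all_analysis.
From mathcomp Require Import ring lra.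

(** The exponential generating function of the sequence C_k is
      G(x) = e^((1-t)x) phi(tx) e^((1-s)x) Phi(sx),
    which is again a limit of products of factors a x + b (a >= 0, b > 0) and
    of truncated exponentials of c x with c >= 0.  That such a G generates a
    multiplier sequence is the easy half of the Polya-Schur theorem.  It rests
    on the formula
      T p(z) = (G(zD) p)(0),   D = d/dy acting on p = p(y),
    valid for the operator T with T(x^k) = G^(k)(0) x^k.

    Fix z with Im z >= 0.  If f has no zero in the open upper half plane, then
    neither does b f + a z f': unless f is constant, Im (f'/f) < 0 there, so
    f'/f cannot equal - b / (a z) ([Im_logderiv_lt0], [stab_linear]).  For
    c >= 0 the exponential of c z D is the translation y -> y + c z, which
    also preserves this class ([stab_exp_trunc]).  The composition of such
    operators applied to a real-rooted p therefore yields a polynomial in y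
    without zeros in the open upper half plane.  As y = 0 lies on the boundary
    of that half plane, G is first multiplied by e^(x/n), which moves the
    evaluation point to z/n ([hyperbolic_limit_multiplier]).

    The limit is taken for coefficients of polynomials of bounded degree.
    Hurwitz's theorem has an elementary proof in this case: a zero-free p
    satisfies |p(w)| <= |p(z)| (1 + |w - z| / Im z)^n for every w
    ([upper_free_bound]), an inequality that passes to the limit and shows
    that a limit with a zero in the upper half plane is 0 ([hurwitz]).

    It remains to approximate phi coefficientwise from its product form
    ([LP_plus_limit]).  The coefficients of the truncations of
    x^m e^(sigma x) prod (1 + x / x_k) increase with the truncation, and these
    polynomials converge at each r > 0, so the coefficients converge and the
    limits sum to the product form ([coef_cvg_mono]); by uniqueness of power
    series they are the Taylor coefficients of phi up to the constant c
    ([LP_product_coefs]).  The factor x^m would annihilate polynomials of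
    small degree, so it is approximated by (x + 1/n)^m.  When it is phi(-x)
    that has the product form, nonnegativity of the Taylor coefficients forces
    phi to be 0 or a monomial: otherwise two consecutive coefficients would have
    opposite signs. *)

Set Implicit Arguments.
Unset Strict Implicit.
Unset Printing Implicit Defensive.

Import Order.TTheory GRing.Theory Num.Theory numFieldNormedType.Exports.
Local Open Scope ring_scope.

(** * Polynomials in z D and the upper half plane *)

Section DiffOp.
Variable C : fieldType.
Implicit Types (z w : C) (f p q : {poly C}) (n : nat).

(** This is q(zD) f; the sum stops at [size f] because higher derivatives of f
    vanish, so q may as well be a truncation of a power series. *)
Definition diffop z q f : {poly C} :=
  \sum_(k < size f) (q`_k * z ^+ k) *: f^`(k).

Lemma diffopE n z q f : (size f <= n)%N ->
  diffop z q f = \sum_(k < n) (q`_k * z ^+ k) *: f^`(k).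
Proof.
move=> le_fn; rewrite /diffop.
rewrite (big_ord_widen _ (fun k => (q`_k * z ^+ k) *: f^`(k)) le_fn).
rewrite big_mkcond; apply: eq_bigr => k _.
by case: ltnP => // le_fk; rewrite derivn_poly0 // scaler0.
Qed.

Lemma diffopD z p q f : diffop z (p + q) f = diffop z p f + diffop z q f.
Proof.
rewrite /diffop -big_split; apply: eq_bigr => k _ /=.
by rewrite coefD mulrDl scalerDl.
Qed.

Lemma diffopC z c f : diffop z c%:P f = c *: f.
Proof.
rewrite (diffopE _ _ (leqnSn _)) big_ord_recl coefC mulr1 big1 ?addr0 // => i _.
by rewrite coefC mul0r scale0r.
Qed.

Lemma diffopMC z c q f : diffop z (c%:P * q) f = c *: diffop z q f.
Proof.
rewrite /diffop scaler_sumr; apply: eq_bigr => k _.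
by rewrite coefCM scalerA mulrA.
Qed.

Lemma diffopMX z q f : diffop z (q * 'X) f = z *: (diffop z q f)^`().
Proof.
rewrite (diffopE _ _ (leqnSn _)) big_ord_recl coefMX mul0r scale0r add0r.
rewrite raddf_sum scaler_sumr; apply: eq_bigr => k _.
rewrite coefMX /= derivZ -derivnS scalerA; congr (_ *: _).
by rewrite exprS mulrCA.
Qed.

Lemma diffopM z p q f : diffop z (p * q) f = diffop z p (diffop z q f).
Proof.
elim/poly_ind: p => [|p c IHp].
  by rewrite mul0r -[0]/(0%:P) !diffopC !scale0r.
rewrite mulrDl mulrAC !diffopD !diffopMX diffopMC IHp; congr (_ + _).
by rewrite diffopC.
Qed.

Lemma size_diffop z q f : (size (diffop z q f) <= size f)%N.
Proof.
apply/leq_sizeP => j le_fj; rewrite coef_sum big1 // => k _.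
rewrite coefZ coef_derivn (@nth_default _ 0 f) ?mul0rn ?mulr0 //.
by apply: leq_trans le_fj _; rewrite leq_addl.
Qed.

Lemma diffop_scale z t q f :
  diffop z (\poly_(k < size q) (t ^+ k * q`_k)) f = diffop (t * z) q f.
Proof.
apply: eq_bigr => k _; rewrite coef_poly exprMn mulrCA mulrA.
by case: ltnP => // /leq_sizeP ->; rewrite // !mulr0 ?mul0r.
Qed.

End DiffOp.

Section UpperHalfPlane.
Variable C : numClosedFieldType.
Implicit Types (z w : C) (f p q : {poly C}) (n : nat).

(** The zero polynomial is excluded, so that an operator preserving this class
    annihilates none of its members. *)
Definition upper_free f := forall w, 0 < 'Im w -> f.[w] != 0.

(** Up to the positive factor |f(w)|^2 this is the imaginary part of
    f'/f = sum 1 / (w - r), and every root r lies below w.  The product form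
    avoids the division and allows an induction on the roots. *)
Lemma Im_logderiv_lt0 f w : upper_free f -> (1 < size f)%N -> 0 < 'Im w ->
  'Im (f^`().[w] * (f.[w])^*) < 0.
Proof.
move=> free_f szf; have [rs] := closed_field_poly_normal f.
have: lead_coef f != 0 by rewrite lead_coef_eq0 -size_poly_gt0 ltnW.
move: (lead_coef f) => c c0 def_f; subst f; move: szf.
have rs_low r : r \in rs -> 'Im r <= 0.
  move=> rs_r; rewrite real_leNgt ?real0 ?Creal_Im //; apply/negP => /free_f.
  by rewrite hornerZ (rootP _) ?mulr0 ?eqxx // root_prod_XsubC.
rewrite size_scale // derivZ !hornerZ rmorphM mulrACA -normCK.
rewrite ImMl ?rpredX ?normr_real // => szf Iw.
rewrite pmulr_rlt0 ?exprn_gt0 ?normr_gt0 //; move: szf => {c0 free_f}.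
set P := \prod_(_ <- _) _.
suff: 'Im (P^`().[w] * P.[w]^*) <= 0 ?= iff (rs == [::]).
  rewrite lt_neqAle /P; case=> -> ->; rewrite andbT.
  (* strict unless there is no root, that is, unless f is constant *)
  by case: (rs) => [|? ?] //; rewrite big_nil size_poly1.
rewrite {}/P; elim: rs rs_low => [|r rs IHrs] rs_low.
  rewrite big_nil derivC horner0 mul0r raddf0; exact/leif_refl.
have {}IHrs: 'Im ((\prod_(z <- rs) ('X - z%:P))^`().[w] *
  ((\prod_(z <- rs) ('X - z%:P)).[w])^*) <= 0.
  by apply: (IHrs _).1 => s rs_s; rewrite rs_low // inE rs_s orbT.
have Iwr : 0 < 'Im (w - r).
  rewrite raddfB subr_gt0; apply: le_lt_trans Iw.
  by rewrite rs_low // mem_head.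
have P0 : (\prod_(z <- rs) ('X - z%:P)).[w] != 0.
  rewrite -rootE root_prod_XsubC; apply/negP => rs_w.
  have le0 : 'Im w <= 0 by rewrite rs_low // inE rs_w orbT.
  by have := lt_le_trans Iw le0; rewrite ltxx.
rewrite big_cons; set P := \prod_(_ <- _) _ in IHrs P0 *.
suff: 'Im ((('X - r%:P) * P)^`().[w] * (('X - r%:P) * P).[w]^*) < 0.
  by move=> lt0; split; [exact: ltW | rewrite lt_eqF].
rewrite derivM derivXsubC mul1r hornerD !hornerM hornerXsubC rmorphM mulrDl.
rewrite mulrCA -normCK mulrACA -normCK raddfD /=.
have nr (u : C) : `|u| ^+ 2 \is Num.real by rewrite rpredX ?normr_real.
rewrite (ImMr (nr P.[w])) (ImMl (nr (w - r))) Im_conj.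
apply: ltr_wnDr; first by rewrite mulr_ge0_le0 ?exprn_ge0.
by rewrite mulNr oppr_lt0 mulr_gt0 // exprn_gt0 // normr_gt0.
Qed.

(** The bound on the degree makes room for truncated exponentials, which act
    as translations only on polynomials of degree below the truncation. *)
Definition stab n q := forall z f, 0 <= 'Im z -> (size f <= n)%N ->
  upper_free f -> upper_free (diffop z q f).

Lemma stabM n p q : stab n p -> stab n q -> stab n (p * q).
Proof.
move=> stab_p stab_q z f z0 szf free_f; rewrite diffopM.
by apply: stab_p; [| exact: leq_trans (size_diffop _ _ _) szf | exact: stab_q].
Qed.

Lemma stabC n c : c != 0 -> stab n c%:P.
Proof.
move=> c0 z f _ _ free_f w w0.
by rewrite diffopC hornerZ mulf_neq0 ?free_f.
Qed.

Lemma stab_prod n (I : Type) (r : seq I) (P : pred I) (F : I -> {poly C}) :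
  (forall i, P i -> stab n (F i)) -> stab n (\prod_(i <- r | P i) F i).
Proof.
move=> stabF; elim/big_rec: _ => [|i q Pi]; first exact/stabC/oner_neq0.
by apply: stabM; exact: stabF.
Qed.

Lemma stab_scale n t q : 0 <= t -> stab n q ->
  stab n (\poly_(k < size q) (t ^+ k * q`_k)).
Proof.
move=> t0 stab_q z f z0 szf; rewrite diffop_scale.
by apply: stab_q; rewrite // ImMl ?mulr_ge0 ?ger0_real.
Qed.

(** A zero w of b f + a z f' would give f(w) = - e f'(w) with e = a z / b in
    the closed upper half plane, making f'(w) times the conjugate of f(w) have
    imaginary part Im e |f'(w)|^2 >= 0, against [Im_logderiv_lt0]. *)
Lemma stab_linear n a b : 0 <= a -> 0 < b -> stab n (a *: 'X + b%:P).
Proof.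
move=> a0 b0 z f z0 _ free_f w w0; apply/eqP.
rewrite -mul_polyC diffopD diffopC diffopMX diffopC derivZ scalerA.
rewrite hornerD !hornerZ => eq0.
have b_neq0 : b != 0 by rewrite gt_eqF.
pose e := a * z / b; have e0 : 0 <= 'Im e.
  rewrite /e ImMr ?rpredV ?gtr0_real // ImMl ?ger0_real //.
  by apply: mulr_ge0; [exact: mulr_ge0 | rewrite invr_ge0 ltW].
have fwE : f.[w] = - (e * f^`().[w]).
  apply: (mulfI b_neq0); apply/eqP; rewrite -subr_eq0 -eq0 /e.
  by apply/eqP; field.
have [szf|szf] := ltnP 1 (size f); last first.
  have := free_f w w0.
  by rewrite fwE (size1_polyC szf) derivC horner0 mulr0 oppr0 eqxx.
have := Im_logderiv_lt0 free_f szf w0; rewrite fwE.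
rewrite rmorphN rmorphM mulrN mulrCA -normCK raddfN /=.
rewrite ImMr ?rpredX ?normr_real // Im_conj mulNr opprK.
move=> lt0; have ge0 : 0 <= 'Im e * `|f^`().[w]| ^+ 2.
  by apply: mulr_ge0 => //; exact: exprn_ge0.
by have := lt_le_trans lt0 ge0; rewrite ltxx.
Qed.

(** Taylor's formula: the exponential of a z D is translation by a z. *)
Lemma horner_diffop_exp m z a f w : (size f <= m)%N ->
  (diffop z (\poly_(k < m) (a ^+ k / k`!%:R)) f).[w] = f.[w + a * z].
Proof.
move=> szm; rewrite (nderiv_taylor_wide (mulrC _ _) szm) (diffopE _ _ szm).
rewrite horner_sum; apply: eq_bigr => k _.
rewrite coef_poly ltn_ord hornerZ nderivn_def hornerMn.
rewrite exprMn -[_ *+ _`!]mulr_natr.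
by field; rewrite pnatr_eq0 -lt0n fact_gt0.
Qed.

Lemma stab_exp_trunc n m a : 0 <= a -> (n <= m)%N ->
  stab n (\poly_(k < m) (a ^+ k / k`!%:R)).
Proof.
move=> a0 le_nm z f z0 szf free_f w w0.
rewrite horner_diffop_exp; last exact: leq_trans szf le_nm.
by apply: free_f; rewrite raddfD /= ImMl ?ger0_real // ltr_wpDr // mulr_ge0.
Qed.

(** Each root r satisfies |z - r| >= Im z, hence
    |w - r| <= |z - r| (1 + |w - z| / Im z); the inequality is the product of
    these over the roots. *)
Lemma upper_free_bound n p z w : upper_free p -> (size p <= n)%N ->
  0 < 'Im z -> `|p.[w]| <= `|p.[z]| * (1 + `|w - z| / 'Im z) ^+ n.
Proof.
move=> free_p szp z0; set K := 1 + _.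
have K1 : 1 <= K by rewrite lerDl divr_ge0 // ltW.
have [rs def_p] := closed_field_poly_normal p.
have [->|p0] := eqVneq p 0; first by rewrite !horner0 normr0 mul0r.
have lc0 : lead_coef p != 0 by rewrite lead_coef_eq0.
have rs_low r : r \in rs -> 'Im r <= 0.
  rewrite real_leNgt ?real0 ?Creal_Im // => rs_r; apply/negP => /free_p.
  by rewrite def_p hornerZ (rootP _) ?mulr0 ?eqxx // root_prod_XsubC.
have le_rs_n : (size rs <= n)%N.
  by rewrite ltnW // (leq_trans _ szp) // def_p size_scale // size_prod_XsubC.
rewrite def_p !hornerZ !normrM -mulrA ler_wpM2l // !horner_prod !normr_prod.
apply: (@le_trans _ _ ((\prod_(r <- rs) `|('X - r%:P).[z]|) * K ^+ size rs));
  last first.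
  by rewrite ler_wpM2l ?prodr_ge0 // ler_weXn2l.
elim: rs rs_low {def_p le_rs_n} => [|r rs IHrs] rs_low.
  by rewrite !big_nil mulr1.
rewrite !big_cons exprS mulrACA ler_pM ?prodr_ge0 //; last first.
  by apply: IHrs => s rs_s; rewrite rs_low // inE rs_s orbT.
rewrite !hornerXsubC.
have -> : w - r = (z - r) + (w - z) by ring.
rewrite (le_trans (ler_normD _ _)) // mulrDr mulr1 lerD2l mulrCA.
rewrite ler_peMr // ler_pdivlMr // mul1r.
apply: le_trans (_ : 'Im (z - r) <= _).
  by rewrite raddfB lerDl oppr_ge0 rs_low // mem_head.
have := (leif_Re_Creal (- ('i * (z - r)))).1.
by rewrite raddfN /= ReMil opprK normrN normrM normCi mul1r.
Qed.

End UpperHalfPlane.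

Local Open Scope classical_set_scope.

(** * Power series on the positive half line *)

Section PowerSeries.
Variable R : realType.
Implicit Types (g d : nat -> R) (r : R).

Lemma cvg_sum_ord (N : nat) (u : nat -> nat -> R) (l : nat -> R) :
  (forall k, (k < N)%N -> u k @ \oo --> l k) ->
  (fun n => \sum_(k < N) u k n) @ \oo --> \sum_(k < N) l k.
Proof.
move=> ul; apply: cvg_big => [|k _]; first exact: add_continuous.
exact: ul.
Qed.

Lemma geometric_half_le2 n r : 0 <= r <= 2^-1 -> \sum_(k < n) r ^+ k <= 2.
Proof.
move=> /andP[r0 r2]; suff: \sum_(k < n) r ^+ k <= 2 - 2 * r ^+ n.
  by move=> le_n; rewrite (le_trans le_n) // gerBl mulr_ge0 ?exprn_ge0.
elim: n => [|n IHn]; first by rewrite big_ord0 expr0; lra.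
rewrite big_ord_recr /= exprS; have := exprn_ge0 n r0; nra.
Qed.

(** With |d_k| <= M, the terms of positive degree contribute at most 2 M r for
    r <= 1/2; let r tend to 0. *)
Lemma pseries0_coef0 d :
  (forall r, 0 < r -> series (fun k => d k * r ^+ k) @ \oo --> (0 : R)) ->
  d 0%N = 0.
Proof.
move=> d0.
have [M M0 leM] : exists2 M, 0 < M & forall k, `|d k| <= M.
  have cvg1 : cvgn (series (fun k => d k * 1 ^+ k)).
    by apply/cvg_ex; exists 0; exact: d0.
  have := cvgP _ (cvg_series_cvg_0 cvg1).
  move=> /cvg_seq_bounded/pinfty_ex_gt0[M M0 leM].
  by exists M => // k; have := leM k I; rewrite /= expr1n mulr1.
have bound r : 0 < r <= 2^-1 -> `|d 0%N| <= 2 * M * r.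
  move=> /andP[r0 r2].
  suff: `|d 0%N| - 2 * M * r <= 0 by rewrite subr_le0.
  have cvgS :
      (fun n => `|series (fun k => d k * r ^+ k) n.+1|) @ \oo --> (0 : R).
    rewrite -(normr0 R); apply: cvg_norm; rewrite (cvg_shiftS (series _)).
    exact: d0.
  apply: (cvgr_to_ge cvgS); apply: nearW => n /=.
  rewrite /series /= big_mkord big_ord_recl expr0 mulr1.
  under eq_bigr => k _ do rewrite lift0 exprS mulrCA.
  rewrite -mulr_sumr; apply: le_trans (lerB_normD _ _).
  rewrite lerB // normrM gtr0_norm // mulrC ler_wpM2r ?(ltW r0) //.
  apply: (le_trans (ler_norm_sum _ _ _)).
  apply: (@le_trans _ _ (\sum_(k < n) M * r ^+ k)).
    apply: ler_sum => k _; rewrite normrM normrX (gtr0_norm r0).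
    by rewrite ler_wpM2r ?exprn_ge0 ?(ltW r0).
  rewrite -mulr_sumr mulrC ler_wpM2r ?(ltW M0) // geometric_half_le2 //.
  by rewrite ltW.
apply/eqP; rewrite -normr_le0; apply/ler_addgt0Pl => e e0; rewrite addr0.
pose r := Num.min 2^-1 (e / (2 * M)).
have r0 : 0 < r by rewrite lt_min invr_gt0 ltr0n divr_gt0 ?mulr_gt0.
have r2 : r <= 2^-1 by rewrite ge_min lexx.
have /le_trans : `|d 0%N| <= 2 * M * r by rewrite bound // r0.
by apply; rewrite mulrC -ler_pdivlMr ?mulr_gt0 // ge_min lexx orbT.
Qed.

Lemma pseries0_coefs d :
  (forall r, 0 < r -> series (fun k => d k * r ^+ k) @ \oo --> (0 : R)) ->
  forall k, d k = 0.
Proof.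
move=> d0 k; elim: k d d0 => [|k IHk] d d0; first exact: pseries0_coef0.
apply: (IHk (d \o S)) => r r0 /=.
rewrite -[X in _ --> X](mulr0 r^-1).
have := d0 r r0; rewrite -cvg_shiftS => /(cvgMl_tmp (a := r^-1)).
apply: cvg_trans; apply: near_eq_cvg; apply: nearW => n /=.
rewrite /series /= !big_mkord big_ord_recl (pseries0_coef0 d0) mul0r add0r.
rewrite mulr_sumr; apply: eq_bigr => i _; rewrite lift0 exprS.
by rewrite mulrCA mulKf // gt_eqF.
Qed.

Lemma pseries_unique g d (l : R -> R) :
  (forall r, 0 < r -> series (fun k => g k * r ^+ k) @ \oo --> l r) ->
  (forall r, 0 < r -> series (fun k => d k * r ^+ k) @ \oo --> l r) ->
  forall k, g k = d k.
Proof.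
move=> gl dl k; apply/eqP; rewrite -subr_eq0; apply/eqP.
apply: (@pseries0_coefs (fun k => g k - d k)) => r r0.
rewrite -(subrr (l r)); apply: cvg_trans (cvgB (gl r r0) (dl r r0)).
apply: near_eq_cvg; apply: nearW => n /=.
rewrite !fctE /series /= -sumrB; apply: eq_bigr => i _; by rewrite mulrBl.
Qed.

Definition coef_cvg (q : nat -> {poly R}) g :=
  forall k, (fun n => (q n)`_k) @ \oo --> g k.

(** Stated with the lower bound 0 so that it is preserved by products. *)
Definition coef_le (p q : {poly R}) := forall k, 0 <= p`_k <= q`_k.

Lemma coef_leM p p' q q' : coef_le p p' -> coef_le q q' ->
  coef_le (p * q) (p' * q').
Proof.
move=> le_p le_q k; rewrite !coefM; apply/andP; split.
  apply: sumr_ge0 => i _; case/andP: (le_p i) => p0 _.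
  by case/andP: (le_q (k - i)%N) => q0 _; rewrite mulr_ge0.
apply: ler_sum => i _; case/andP: (le_p i) => p0 le_pi.
by case/andP: (le_q (k - i)%N) => q0 le_qi; rewrite ler_pM.
Qed.

(** Dini-type argument.  Each coefficient is nondecreasing and bounded by h(1),
    hence converges.  A partial sum of the limit series at r is a limit of
    partial sums of H_n(r) <= h(r), so the series sums to at most h(r); and it
    dominates every H_n(r), so it sums to at least h(r). *)
Lemma coef_cvg_mono (H : nat -> {poly R}) (h : R -> R) :
  (forall n, coef_le (H n) (H n.+1)) ->
  (forall r, 0 < r -> (fun n => (H n).[r]) @ \oo --> h r) ->
  exists2 b, coef_cvg H b &
    forall r, 0 < r -> series (fun k => b k * r ^+ k) @ \oo --> h r.
Proof.
move=> mono Hh.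
have H0 n k : 0 <= (H n)`_k by case/andP: (mono n k).
have H_nd k : {homo (fun n => (H n)`_k) : m n / (m <= n)%N >-> m <= n}.
  by apply: (homo_leq (fun x => lexx x) le_trans) => n; case/andP: (mono n k).
have HE n N r : (size (H n) <= N)%N ->
    (H n).[r] = \sum_(k < N) (H n)`_k * r ^+ k.
  exact: horner_coef_wide.
have sum_le n N r : 0 < r -> \sum_(k < N) (H n)`_k * r ^+ k <= (H n).[r].
  move=> r0; rewrite (HE n (N + size (H n))%N) ?leq_addl //.
  rewrite big_split_ord /= lerDl sumr_ge0 // => k _.
  by rewrite mulr_ge0 // exprn_ge0 // ltW.
have H_le n r : 0 < r -> (H n).[r] <= h r.
  move=> r0; apply: (cvgr_to_ge (Hh r r0)); exists n => // m /= le_nm.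
  rewrite (HE n (maxn (size (H n)) (size (H m)))) ?leq_maxl //.
  rewrite (HE m (maxn (size (H n)) (size (H m)))) ?leq_maxr //.
  apply: ler_sum => k _; rewrite ler_wpM2r ?exprn_ge0 ?(ltW r0) //; exact: H_nd.
have coef_bound n k : (H n)`_k <= h 1.
  apply: le_trans (H_le n 1 ltr01); apply: le_trans (sum_le n k.+1 1 ltr01).
  rewrite big_ord_recr /= expr1n mulr1 lerDr sumr_ge0 // => i _.
  by rewrite expr1n mulr1.
have cvgH k : cvgn (fun n => (H n)`_k).
  by apply: nondecreasing_is_cvgn => //; exists (h 1) => _ [n _ <-].
pose b k := limn (fun n => (H n)`_k).
have Hb : coef_cvg H b by move=> k; exact: cvgH.
have b0 k : 0 <= b k.
  by apply: (cvgr_to_ge (Hb k)); apply: nearW => n; exact: H0.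
exists b => // r r0; set S := series _.
have S_nd : nondecreasing_seq S.
  apply: nondecreasing_series => k _ _.
  by rewrite mulr_ge0 // exprn_ge0 // ltW.
have S_le N : S N <= h r.
  have cvgN : (fun n => \sum_(k < N) (H n)`_k * r ^+ k) @ \oo --> S N.
    rewrite /S /series /= big_mkord.
    apply: (@cvg_sum_ord N (fun k n => (H n)`_k * r ^+ k)
      (fun k => b k * r ^+ k)) => k _.
    exact: cvgMr_tmp (Hb k).
  apply: (cvgr_to_le cvgN); apply: nearW => n.
  by rewrite (le_trans (sum_le _ _ _ r0)) // H_le.
have cvgS : cvgn S.
  by apply: nondecreasing_is_cvgn => //; exists (h r) => _ [n _ <-].
suff -> : h r = limn S by [].
apply/eqP; rewrite eq_le; apply/andP; split; last first.
  by apply: (cvgr_to_le cvgS); apply: nearW.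
apply: (cvgr_to_le (Hh r r0)); apply: nearW => n.
apply: le_trans (nondecreasing_cvgn_le S_nd cvgS (size (H n))).
rewrite (HE n _ r (leqnn _)) /S /series /= big_mkord; apply: ler_sum => k _.
rewrite ler_wpM2r ?exprn_ge0 ?(ltW r0) //.
exact: (nondecreasing_cvgn_le (H_nd k) (cvgH k) n).
Qed.

End PowerSeries.

(** * Real polynomials and Hurwitz's theorem *)

Section RealStability.
Variable R : realType.
Implicit Types (p q : {poly R}) (g h : nat -> R).

Local Notation "p ^C" := (map_poly (real_complex R) p) : ring_scope.

(** Stability of a real polynomial, as an operator on complex ones. *)
Definition rstab n q := stab n q^C.

Lemma rstabM n p q : rstab n p -> rstab n q -> rstab n (p * q).
Proof. by rewrite /rstab rmorphM; exact: stabM. Qed.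

Lemma rstabC n c : c != 0 -> rstab n c%:P.
Proof.
by move=> c0; rewrite /rstab map_polyC; apply: stabC; rewrite fmorph_eq0.
Qed.

Lemma rstab_linear n a b : 0 <= a -> 0 < b -> rstab n (a *: 'X + b%:P).
Proof.
move=> a0 b0; rewrite /rstab rmorphD /= map_polyZ map_polyX map_polyC /=.
by apply: stab_linear; rewrite ?ler0c ?ltcR.
Qed.

Lemma rstab_prod n (I : Type) (r : seq I) (F : I -> {poly R}) :
  (forall i, rstab n (F i)) -> rstab n (\prod_(i <- r) F i).
Proof.
move=> stabF; rewrite /rstab rmorph_prod; apply: stab_prod => i _.
exact: stabF.
Qed.

Definition scale_poly t q : {poly R} := \poly_(k < size q) (t ^+ k * q`_k).

Lemma coef_scale_poly t q k : (scale_poly t q)`_k = t ^+ k * q`_k.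
Proof.
by rewrite coef_poly; case: ltnP => // ?; rewrite nth_default ?mulr0.
Qed.

Lemma rstab_scale n t q : 0 <= t -> rstab n q -> rstab n (scale_poly t q).
Proof.
move=> t0 /(stab_scale (t := t%:C)%C) stab_q; rewrite /rstab.
suff -> : (scale_poly t q)^C = \poly_(k < size q^C) ((t%:C)%C ^+ k * q^C`_k).
  by apply: stab_q; rewrite ler0c.
apply/polyP => k; rewrite coef_map coef_scale_poly coef_poly size_map_poly.
case: ltnP => [_|le_qk]; last by rewrite nth_default // mulr0 raddf0.
by rewrite coef_map /= (rmorphM (real_complex R)) (rmorphXn (real_complex R)).
Qed.

Definition exp_poly a n : {poly R} := \poly_(k < n.+1) (a ^+ k / k`!%:R).

Lemma map_exp_poly a n :
  (exp_poly a n)^C = \poly_(k < n.+1) ((a%:C)%C ^+ k / k`!%:R).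
Proof.
apply/polyP => k; rewrite coef_map !coef_poly; case: ltnP => _ //.
rewrite /= (rmorphM (real_complex R)) (rmorphXn (real_complex R)).
by rewrite fmorphV (rmorph_nat (real_complex R)).
Qed.

Lemma rstab_exp_poly n a : 0 <= a -> rstab n (exp_poly a n).
Proof.
move=> a0; rewrite /rstab map_exp_poly.
by apply: stab_exp_trunc; rewrite ?ler0c.
Qed.

(** The evaluation at 0 that turns q(zD) into a diagonal operator. *)
Lemma diffop_at0 z q p :
  (diffop z q^C p^C).[0] = (diag_op (fun k => q`_k * k`!%:R) p)^C.[z].
Proof.
rewrite /diffop horner_sum size_map_poly.
rewrite (@horner_coef_wide _ (size p)); last first.
  by rewrite size_map_poly size_poly.
apply: eq_bigr => k _; rewrite hornerZ !coef_map coef_diag_op /=.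
rewrite horner_coef0 coef_derivn addn0 ffactnn coef_map /=.
rewrite !rmorphM rmorph_nat -mulr_natr /=; ring.
Qed.

Lemma poly_eq0_horner p : (forall w : R[i], p^C.[w] = 0) -> p = 0.
Proof.
move=> p0; apply/eqP; rewrite -(map_poly_eq0 (real_complex R)); apply/eqP.
apply: (@roots_geq_poly_eq0 _ _ [seq k%:R | k <- iota 0 (size p^C)]).
- by apply/allP => w _; apply/rootP.
- by rewrite map_inj_uniq ?iota_uniq //; exact: mulrIn (oner_neq0 _).
- by rewrite size_map size_iota.
Qed.

(** Used for the real and imaginary parts, so that only limits of real
    sequences occur. *)
Lemma cvg_additive_horner (N : nat) (ps : nat -> {poly R}) p (w : R[i])
    (L : R[i] -> R) :
  {morph L : x y / x + y} -> L 0 = 0 ->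
  (forall a z, L ((a%:C)%C * z) = a * L z) ->
  (forall n, (size (ps n) <= N)%N) -> (size p <= N)%N ->
  (forall k, (fun n => (ps n)`_k) @ \oo --> p`_k) ->
  (fun n => L (ps n)^C.[w]) @ \oo --> L p^C.[w].
Proof.
move=> LD L0 LZ szps szp psp.
have LE (q : {poly R}) : (size q <= N)%N ->
    L q^C.[w] = \sum_(k < N) q`_k * L (w ^+ k).
  move=> szq; rewrite (@horner_coef_wide _ N) ?size_map_poly //.
  rewrite (big_morph L LD L0).
  by apply: eq_bigr => k _; rewrite coef_map LZ.
rewrite LE //; under eq_fun => n do rewrite LE //.
apply: (@cvg_sum_ord _ N (fun k n => (ps n)`_k * L (w ^+ k))
  (fun k => p`_k * L (w ^+ k))) => k _.
exact: cvgMr_tmp.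
Qed.

(** The estimate [upper_free_bound] for the approximants, squared to be
    expressed by real and imaginary parts, passes to the limit: if p(z) = 0
    then p(w) = 0 for all w. *)
Lemma hurwitz (N : nat) (ps : nat -> {poly R}) p :
  (forall n, (size (ps n) <= N)%N) ->
  (forall k, (fun n => (ps n)`_k) @ \oo --> p`_k) ->
  (forall n, upper_free (ps n)^C) -> p != 0 -> upper_free p^C.
Proof.
move=> szps psp free_ps p_neq0 z z0; apply: contra_neq p_neq0 => pz0.
have szp : (size p <= N)%N.
  apply/leq_sizeP => k le_Nk; have := psp k.
  under eq_fun => n do rewrite (nth_default _ (leq_trans (szps n) le_Nk)).
  by move=> /(cvg_unique (@norm_hausdorff _ _) (cvg_cst 0)) <-.
apply: poly_eq0_horner => w.
pose nrm2 (x : R[i]) := complex.Re x ^+ 2 + complex.Im x ^+ 2.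
pose K : R[i] := (1 + `|w - z| / 'Im z) ^+ N.
have K0 : 0 <= K by rewrite exprn_ge0 // addr_ge0 // divr_ge0 // ltW.
have [k Kk] : exists k, K ^+ 2 = (k%:C)%C.
  by apply/complex_realP; rewrite rpredX // ger0_real.
have nrm2_cvg x : (fun n => nrm2 (ps n)^C.[x]) @ \oo --> nrm2 p^C.[x].
  have cvgRe : (fun n => complex.Re (ps n)^C.[x]) @ \oo --> complex.Re p^C.[x].
    apply: (@cvg_additive_horner N ps p x (@complex.Re R)) =>
      // [[? ?] [? ?]|a [u v]] //=.
    by rewrite mul0r subr0.
  have cvgIm : (fun n => complex.Im (ps n)^C.[x]) @ \oo --> complex.Im p^C.[x].
    apply: (@cvg_additive_horner N ps p x (@complex.Im R)) =>
      // [[? ?] [? ?]|a [u v]] //=.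
    by rewrite mul0r addr0.
  by rewrite /nrm2 !expr2; apply: cvgD; apply: cvgM.
have nrm2_le n : nrm2 (ps n)^C.[w] <= nrm2 (ps n)^C.[z] * k.
  rewrite -lecR (rmorphM (real_complex R)) /= -Kk /nrm2 !add_Re2_Im2 -exprMn.
  rewrite ler_pXn2r ?nnegrE ?mulr_ge0 //.
  by apply: upper_free_bound; rewrite ?size_map_poly.
have: nrm2 p^C.[w] <= nrm2 p^C.[z] * k.
  apply: ler_cvg_to (nrm2_cvg w) (cvgMr_tmp (nrm2_cvg z)) _.
  exact: nearW.
rewrite pz0 /nrm2 /= expr0n addr0 mul0r => le0.
apply/eqP; rewrite -normr_eq0 -sqrf_eq0 -add_Re2_Im2; apply/eqP.
congr (_%:C)%C; apply/eqP; rewrite eq_le le0 addr_ge0 ?sqr_ge0 //.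
Qed.

End RealStability.

(** * Coefficientwise limits of hyperbolic polynomials *)

Section Approximation.
Variable R : realType.
Implicit Types (p : {poly R}) (q : nat -> {poly R}) (g h : nat -> R).

Local Notation "p ^C" := (map_poly (real_complex R) p) : ring_scope.

(** Coefficients of the product of the power series with coefficients g, h. *)
Definition cauchy_prod g h k := \sum_(i < k.+1) g i * h (k - i)%N.

Lemma coef_cvgM q q' g h : coef_cvg q g -> coef_cvg q' h ->
  coef_cvg (fun n => q n * q' n) (cauchy_prod g h).
Proof.
move=> qg qh k; rewrite /cauchy_prod.
under eq_fun => n do rewrite coefM.
apply: (@cvg_sum_ord _ k.+1 (fun i n => (q n)`_i * (q' n)`_(k - i))
  (fun i => g i * h (k - i)%N)) => i _.
exact: cvgM (qg i) (qh _).
Qed.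

Lemma coef_cvgZ c q g : coef_cvg q g ->
  coef_cvg (fun n => c%:P * q n) (fun k => c * g k).
Proof.
move=> qg k; under eq_fun => n do rewrite coefCM.
exact: cvgMl_tmp.
Qed.

Lemma coef_cvg_scale t q g : coef_cvg q g ->
  coef_cvg (fun n => scale_poly t (q n)) (fun k => t ^+ k * g k).
Proof.
move=> qg k; under eq_fun => n do rewrite coef_scale_poly.
exact: cvgMl_tmp.
Qed.

Lemma coef_cvg_exp (a : R) :
  coef_cvg (exp_poly a) (fun k => a ^+ k / k`!%:R).
Proof.
move=> k; apply: cvg_near_cst; exists k => // n /= le_kn.
by rewrite coef_poly ltnS le_kn.
Qed.

Lemma coef_cvg_unique q g h : coef_cvg q g -> coef_cvg q h -> g =1 h.
Proof.
move=> qg qh k.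
exact: (cvg_unique (@norm_hausdorff _ _) (qg k) (qh k)).
Qed.

Lemma cauchy_delta m g k :
  cauchy_prod (fun i => (i == m)%:R) g k =
    if (m <= k)%N then g (k - m)%N else 0.
Proof.
rewrite /cauchy_prod; case: leqP => [le_mk|lt_km].
  rewrite (bigD1 (Ordinal (le_mk : (m < k.+1)%N))) //= eqxx mul1r.
  rewrite big1 ?addr0 // => i.
  by rewrite -val_eqE /= => /negPf->; rewrite mul0r.
rewrite big1 // => i _.
by rewrite ltn_eqF ?mul0r // (leq_trans (ltn_ord i)).
Qed.

Lemma coef_cvg_eq q g h : coef_cvg q g -> g =1 h -> coef_cvg q h.
Proof. by move=> qg gh k; rewrite -gh; exact: qg. Qed.

Lemma coef_cvg_delta1 :
  coef_cvg (fun n => 1 *: 'X + (n.+1%:R^-1)%:P) (fun k => (k == 1)%:R : R).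
Proof.
move=> k; under eq_fun => n do rewrite coefD coefZ mul1r coefX coefC.
have tail0 : (fun n => if k == 0 then n.+1%:R^-1 else 0) @ \oo --> (0 : R).
  by case: eqP => _; [exact: cvg_harmonic | exact: cvg_cst].
have := cvgD (cvg_cst ((k == 1)%:R : R)) tail0; rewrite addr0 => lim.
exact: lim.
Qed.

(** Stable approximations of the monomial x^m, which is not itself stable: its
    operator annihilates the polynomials of degree less than m. *)
Lemma coef_cvg_delta m :
  coef_cvg (fun n => (1 *: 'X + (n.+1%:R^-1)%:P) ^+ m)
    (fun k => (k == m)%:R : R).
Proof.
elim: m => [|m IHm].
  by move=> k; under eq_fun => n do rewrite expr0 coef1; exact: cvg_cst.
under eq_fun => n do rewrite exprS.
apply: coef_cvg_eq (coef_cvgM coef_cvg_delta1 IHm) _ => k.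
by rewrite cauchy_delta; case: k => [|k] //=; rewrite subn1.
Qed.

(** Multiplying by these factors does not change a coefficientwise limit. *)
Lemma coef_cvg_exp0 : coef_cvg (fun n => exp_poly n.+1%:R^-1 n)
  (fun k => (k == 0)%:R : R).
Proof.
move=> k; case: k => [|k].
  under eq_fun => n do rewrite coef_poly expr0 divr1.
  exact: cvg_cst.
have pow0 : (fun n => (n.+1%:R^-1) ^+ k.+1 / k.+1`!%:R) @ \oo --> (0 : R).
  rewrite -(mul0r k.+1`!%:R^-1); apply: cvgMr_tmp.
  elim: k => [|k IHk]; first exact: cvg_harmonic.
  under eq_fun => n do rewrite exprS.
  have := cvgM cvg_harmonic IHk; rewrite mulr0 => lim; exact: lim.
apply: cvg_trans pow0; apply: near_eq_cvg; exists k.+1 => // n /= le_kn.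
by rewrite coef_poly ltnS le_kn.
Qed.

(** The zero sequence is a separate case because a stable polynomial is never
    zero. *)
Definition hyperbolic_limit g :=
  (exists2 q, coef_cvg q g & forall n, rstab n (q n)) \/ forall k, g k = 0.

(** For Im z > 0 an approximant of T p takes at z the value of q_n(zD) p at a
    small positive multiple of z, a point of the open upper half plane, where it
    does not vanish; [hurwitz] gives the limit.  Zeros in the lower half plane are
    conjugates of zeros in the upper one. *)
Lemma hyperbolic_limit_multiplier q g :
  coef_cvg q g -> (forall n, rstab n (q n)) ->
  multiplier_sequence (fun k => g k * k`!%:R).
Proof.
move=> qg stab_q p real_p; have [->|p0] := eqVneq p 0.
  by left; apply/polyP => k; rewrite coef_diag_op coef0 mulr0.
have free_p : upper_free p^C.
  move=> w w0; case: real_p => [p_eq0|real_p].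
    by rewrite p_eq0 eqxx in p0.
  by apply: contraL w0 => /real_p/Creal_ImP->; rewrite ltxx.
set P := diag_op _ p; have [->|P0] := eqVneq P 0; [by left | right].
have free_P : upper_free P^C.
  (* the shift by N makes the truncation order exceed the degree of p *)
  pose q' n := exp_poly n.+1%:R^-1 n * q n.
  pose N := size p.
  pose ps n := diag_op (fun k => (q' (n + N)%N)`_k * k`!%:R) p.
  apply: (@hurwitz _ N ps) => // [n|k|n z z0].
  - exact: size_poly.
  - rewrite coef_diag_op.
    under eq_fun => n do rewrite coef_diag_op.
    apply: cvgMr_tmp; apply: cvgMr_tmp.
    have q'g : coef_cvg q' g.
      apply: coef_cvg_eq (coef_cvgM coef_cvg_exp0 qg) _ => i.
      by rewrite cauchy_delta subn0.
    by have := q'g k; rewrite -(cvg_shiftn N).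
  - rewrite -diffop_at0.
    rewrite /q' rmorphM diffopM /= map_exp_poly.
    have szp : (size p^C <= n + N)%N by rewrite size_map_poly leq_addl.
    rewrite horner_diffop_exp ?add0r; last first.
      by apply: leq_trans (size_diffop _ _ _) _; rewrite ltnW // ltnS.
    apply: stab_q szp _ _ _ => //; first exact: ltW.
    have h0 : 0 < (((n + N).+1%:R^-1 : R)%:C)%C by rewrite ltcR invr_gt0 ltr0n.
    by rewrite ImMl ?gtr0_real // mulr_gt0.
move=> z Pz; have PzC : root P^C z^*%C.
  rewrite -complex_root_conj; suff -> : map_poly (@conjc R) P^C = P^C by [].
  by apply/polyP => k; rewrite !coef_map; exact: conjc_real.
have Imz0 (w : R[i]) : root P^C w -> 'Im w <= 0.
  move=> Pw; rewrite real_leNgt ?real0 ?Creal_Im //; apply/negP => /free_P.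
  by rewrite -rootE Pw.
apply/Creal_ImP/eqP; rewrite eq_le Imz0 //=.
by have := Imz0 _ PzC; rewrite (Im_conj z) oppr_le0.
Qed.

(** Truncation of e^(sigma x) prod (1 + a_k x); a finite product is encoded by
    a_k = 0 from some point on. *)
Definition LP_poly sigma (a : nat -> R) n : {poly R} :=
  exp_poly sigma n * \prod_(k < n) (a k *: 'X + 1%:P).

Lemma rstab_LP_poly sigma a n : 0 <= sigma -> (forall k, 0 <= a k) ->
  rstab n (LP_poly sigma a n).
Proof.
move=> s0 a0; apply: rstabM; first exact: rstab_exp_poly.
by apply: rstab_prod => k; exact: rstab_linear.
Qed.

Lemma coef_le_LP_poly sigma a n : 0 <= sigma -> (forall k, 0 <= a k) ->
  coef_le (LP_poly sigma a n) (LP_poly sigma a n.+1).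
Proof.
move=> s0 a0; apply: coef_leM => [k|].
  rewrite !coef_poly; have t0 : 0 <= sigma ^+ k / k`!%:R.
    by rewrite divr_ge0 ?exprn_ge0.
  case: (ltnP k n.+1) => [lt_kn|_]; first by rewrite (leqW lt_kn) t0 lexx.
  by case: ifP; rewrite lexx ?t0.
have le_1 k : coef_le 1 (a k *: 'X + 1%:P).
  move=> i; rewrite coefD coefZ coefX polyC1 !coef1.
  case: eqP => [->|_] /=; first by rewrite ?mulr0 ?add0r ?ler01 ?lexx.
  by rewrite ?addr0 ?lexx ?mulr_ge0.
rewrite big_ord_recr /= -[X in coef_le X _]mulr1; apply: coef_leM => //.
elim: n => [|n IHn]; first by move=> i; rewrite big_ord0 lexx coef1 ler0n.
rewrite big_ord_recr /=; apply: coef_leM => // i.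
by case/andP: (le_1 n i) => le0 le1; rewrite lexx andbT (le_trans le0).
Qed.

Lemma coef0_LP_poly sigma a n : (LP_poly sigma a n)`_0 = 1.
Proof.
rewrite coef0M coef_poly expr0 divr1 mul1r -horner_coef0.
rewrite horner_prod big1 // => i _; by rewrite !hornerE ?mulr0 ?add0r.
Qed.

Lemma coef1_LP_poly sigma a n :
  (LP_poly sigma a n.+1)`_1 = sigma + \sum_(k < n.+1) a k.
Proof.
have prod01 m (P := \prod_(k < m) (a k *: 'X + 1%:P)) :
    P`_0 = 1 /\ P`_1 = \sum_(k < m) a k.
  rewrite {}/P; elim: m => [|m [IH0 IH1]]; first by rewrite !big_ord0 !coef1.
  rewrite !big_ord_recr /= !coefM !big_ord_recr !big_ord0 /= IH0 IH1.
  rewrite !coefD !coefZ !coefX !coefC /=; split; ring.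
have [P0 P1] := prod01 n.+1.
rewrite coefM big_ord_recr big_ord_recr big_ord0 /=.
rewrite P0 P1 !coef_poly /= expr0 expr1 fact0 (factS 0) fact0 muln1.
rewrite !divr1; ring.
Qed.

Lemma cvg_exp_poly (sigma r : R) :
  (fun n => (exp_poly sigma n).[r]) @ \oo --> expR (sigma * r).
Proof.
have := @is_cvg_series_exp_coeff R (sigma * r); rewrite -cvg_shiftS.
apply: cvg_trans; apply: near_eq_cvg; apply: nearW => n.
rewrite /= /series /= big_mkord /exp_poly horner_poly.
by apply: eq_bigr => k _; rewrite /exp_coeff /= exprMn mulrAC.
Qed.

Lemma cvg_ofR (u : nat -> R) (z : Cplx R) :
  (fun n => ofR (u n)) @ \oo --> z -> u @ \oo --> complex.Re z.
Proof.
move=> uz; apply/cvgrPdist_lt => e e0.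
have e0' : (0 : Cplx R) < ofR e by rewrite /ofR ltcR.
move/cvgrPdist_lt : uz => /(_ _ e0'); apply: filterS => n.
case: z => x y; rewrite /= normc_def /= ltcR; apply: le_lt_trans.
by rewrite -sqrtr_sqr ler_wsqrtr // lerDl sqr_ge0.
Qed.

Lemma cexp_ofR (x : R) : cexp (ofR x) = ofR (expR x).
Proof. by rewrite /cexp /ofR /= cos0 sin0 mulr1 mulr0. Qed.

Lemma Re_ofRM (x : R) (z : Cplx R) : complex.Re (ofR x * z) = x * complex.Re z.
Proof. by case: z => u v /=; rewrite mul0r subr0. Qed.

(** The values on the positive half line determine the coefficients, so complex
    convergence is only used at real points.  Monotonicity is applied to
    x^m times the truncations, whose coefficients are those of the truncations
    shifted by m. *)
Lemma LP_product_coefs (psi : Cplx R -> Cplx R) g : LP_product_form psi ->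
  (forall r, 0 < r -> series (fun k => g k * r ^+ k) @ \oo -->
     complex.Re (psi (ofR r))) ->
  exists c m sigma (a b : nat -> R), [/\ 0 <= sigma, forall k, 0 <= a k,
    coef_cvg (LP_poly sigma a) b &
    forall k, g k = c * cauchy_prod (fun i => (i == m)%:R) b k].
Proof.
move=> [c [m [sigma [omega [x [P [s0 x0 _ cvgP psiE]]]]]]] g_psi.
pose a k := if in_range omega k then (x k)^-1 else 0.
have a0 k : 0 <= a k.
  by rewrite /a; case: ifP => // /x0 xk; rewrite invr_ge0 ltW.
pose H n := 'X^m * LP_poly sigma a n.
have H_le n : coef_le (H n) (H n.+1).
  apply: coef_leM; last exact: coef_le_LP_poly.
  by move=> i; rewrite coefXn ler0n lexx.
pose h r := r ^+ m * (expR (sigma * r) * complex.Re (P (ofR r))).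
have Hh r : 0 < r -> (fun n => (H n).[r]) @ \oo --> h r.
  move=> r0; under eq_fun => n do rewrite !hornerM hornerXn.
  apply: cvgMl_tmp; apply: cvgM; first exact: cvg_exp_poly.
  apply: cvg_ofR; apply: cvg_trans (cvgP (ofR r)); apply: near_eq_cvg.
  apply: nearW => n; rewrite horner_prod big_mkcond /= /ofR.
  rewrite (rmorph_prod (real_complex R)); apply: eq_bigr => k _.
  rewrite /a; case: ifP => _; rewrite !hornerE /=.
    rewrite (rmorphD (real_complex R)) (rmorphM (real_complex R)) fmorphV.
    by rewrite addrC mulrC.
  by [].
have [b' Hb' b'h] := coef_cvg_mono H_le Hh.
have cvgT : coef_cvg (LP_poly sigma a) (fun k => b' (k + m)%N).
  move=> k; have := Hb' (k + m)%N.
  by under eq_fun => n do rewrite coefXnM ltnNge leq_addl addnK.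
exists c, m, sigma, a, (fun k => b' (k + m)%N); split=> // k.
have -> : cauchy_prod (fun i => (i == m)%:R) (fun k => b' (k + m)%N) k = b' k.
  apply: coef_cvg_unique Hb' k; apply: coef_cvgM cvgT.
  by move=> i; under eq_fun => n do rewrite coefXn; exact: cvg_cst.
apply: (@pseries_unique _ g (fun k => c * b' k) _ g_psi) => r r0.
rewrite psiE; set v := complex.Re _; have -> : v = c * h r.
  rewrite /v /h !mulrA -Re_ofRM; congr (complex.Re (_ * _)).
  rewrite -[ofR sigma * _](rmorphM (real_complex R)) cexp_ofR.
  by rewrite /ofR !(rmorphM (real_complex R)) (rmorphXn (real_complex R)).
have := cvgMl_tmp (a := c) (b'h r r0) => /(_ _) lim.
apply: cvg_trans lim; apply: near_eq_cvg; apply: nearW => n.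
by rewrite /series /= mulr_sumr; apply: eq_bigr => k' _; rewrite mulrA.
Qed.

Lemma real_entire_series (phi : Cplx R -> Cplx R) gamma (r : R) :
  real_entire phi gamma ->
  series (fun k => gamma k / k`!%:R * r ^+ k) @ \oo -->
    complex.Re (phi (ofR r)).
Proof.
move=> /(_ (ofR r)) entire; apply: cvg_ofR.
apply: cvg_trans entire; apply: near_eq_cvg; apply: nearW => n.
rewrite /series /= /ofR (rmorph_sum (real_complex R)); apply: eq_bigr => k _.
by rewrite [RHS](rmorphM (real_complex R)) (rmorphXn (real_complex R)).
Qed.

Lemma hyperbolic_limit_product c m sigma (a b : nat -> R) :
  0 <= sigma -> (forall k, 0 <= a k) -> coef_cvg (LP_poly sigma a) b ->
  hyperbolic_limit (fun k => c * cauchy_prod (fun i => (i == m)%:R) b k).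
Proof.
move=> s0 a0 Tb; have [->|c0] := eqVneq c 0.
  by right=> k; rewrite mul0r.
left; exists (fun n =>
  c%:P * ((1 *: 'X + (n.+1%:R^-1)%:P) ^+ m * LP_poly sigma a n)).
  by apply: coef_cvgZ; apply: coef_cvgM Tb; exact: coef_cvg_delta.
move=> n; apply: rstabM; first exact: rstabC.
apply: rstabM; last exact: rstab_LP_poly.
rewrite -[m]card_ord -prodr_const; apply: rstab_prod => _.
by apply: rstab_linear; rewrite ?ler01 // invr_gt0 ltr0n.
Qed.

(** The linear coefficient of the truncations increases to b_1 and equals
    sigma plus a sum of the a_k; if b_1 <= 0 then sigma and all a_k vanish. *)
Lemma LP_limit_constant sigma (a b : nat -> R) :
  0 <= sigma -> (forall k, 0 <= a k) -> coef_cvg (LP_poly sigma a) b ->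
  b 1 <= 0 -> forall k, b k.+1 = 0.
Proof.
move=> s0 a0 Tb b1.
have le_b1 n : sigma + \sum_(k < n.+1) a k <= b 1.
  apply: (cvgr_to_ge (Tb 1)); exists n.+1 => // -[//|j] /= le_nj.
  rewrite coef1_LP_poly lerD2l.
  rewrite (big_ord_widen _ a (le_nj : n.+1 <= j.+1)%N) big_mkcond /=.
  by apply: ler_sum => k _; case: ifP.
have sum0 n : sigma + \sum_(k < n.+1) a k = 0.
  apply/eqP; rewrite eq_le (le_trans (le_b1 n)) //=.
  by rewrite addr_ge0 // sumr_ge0.
have sigma0 : sigma = 0.
  apply/eqP; rewrite eq_le s0 andbT -(sum0 0%N) lerDl sumr_ge0 //.
have a_eq0 k : a k = 0.
  apply/eqP; rewrite eq_le a0 andbT -(sum0 k) big_ord_recr /= addrA lerDr.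
  by rewrite addr_ge0 // sumr_ge0.
have T1 n : LP_poly sigma a n = 1.
  rewrite /LP_poly big1 ?mulr1 => [|k _]; last first.
    by rewrite a_eq0 scale0r add0r polyC1.
  apply/polyP => k; rewrite coef_poly coef1 sigma0 expr0n.
  by case: k => [|k]; rewrite /= ?divr1 ?mul0r ?if_same.
move=> k; have := Tb k.+1; under eq_fun => n do rewrite T1 coef1.
by move=> /(cvg_unique (@norm_hausdorff _ _) (cvg_cst 0)) <-.
Qed.

Lemma LP_plus_limit (phi : Cplx R -> Cplx R) gamma : LP_plus phi gamma ->
  hyperbolic_limit (fun k => gamma k / k`!%:R).
Proof.
move=> [[entire form] gamma0].
pose g k := gamma k / k`!%:R.
have g0 k : 0 <= g k by rewrite divr_ge0.
have eq_limit g1 g2 : g1 =1 g2 -> hyperbolic_limit g1 -> hyperbolic_limit g2.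
  by move=> /funext ->.
case: form => /LP_product_coefs extract.
  have [|c [m [sigma [a [b [s0 a0 Tb gE]]]]]] := extract g.
    by move=> r _; exact: real_entire_series.
  by apply: eq_limit (hyperbolic_limit_product c m s0 a0 Tb) => k; rewrite -gE.
(* here phi(-x) has the product form *)
have [|c [m [sigma [a [b [s0 a0 Tb gE]]]]]] :=
  extract (fun k => (-1) ^+ k * g k).
  move=> r _; have := real_entire_series (r := - r) entire.
  rewrite /ofR (rmorphN (real_complex R)) => lim; apply: cvg_trans lim.
  apply: near_eq_cvg; apply: nearW => n; rewrite /series /=.
  apply: eq_bigr => k _; by rewrite (exprNn r) mulrCA mulrA.
have b0 : b 0%N = 1.
  have := Tb 0%N; under eq_fun => n do rewrite coef0_LP_poly.
  by move=> /(cvg_unique (@norm_hausdorff _ _) (cvg_cst (1 : R))) <-.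
have gE' k : g k = (-1) ^+ k * (c * cauchy_prod (fun i => (i == m)%:R) b k).
  by rewrite -gE mulrA -exprMn mulrNN mulr1 expr1n mul1r.
have [c0|c0] := eqVneq c 0.
  by right=> k; rewrite -/(g k) gE' c0 mul0r mulr0.
have sc0 : 0 < (-1) ^+ m * c.
  have := g0 m; rewrite gE' cauchy_delta leqnn subnn b0 mulr1 => sc0.
  by rewrite lt_neqAle sc0 eq_sym mulf_neq0 // signr_eq0.
(* g_m = (-1)^m c > 0 while g_(m+1) = - (-1)^m c b_1 *)
have b1 : b 1 <= 0.
  have := g0 m.+1; rewrite gE' cauchy_delta leqnSn subSnn exprS mulN1r mulNr.
  by rewrite mulrA oppr_ge0 pmulr_rle0.
have b_eq0 := LP_limit_constant s0 a0 Tb b1.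
apply: eq_limit (hyperbolic_limit_product ((-1) ^+ m * c) m s0 a0 Tb) => k.
rewrite -/(g k) gE' cauchy_delta mulrA.
have [->|neq_km] := eqVneq k m; first by [].
case: leqP => [le_mk|_]; last by rewrite !mulr0.
rewrite -(prednK (_ : 0 < k - m)%N) ?b_eq0 ?mulr0 //.
by rewrite subn_gt0 ltn_neqAle eq_sym neq_km.
Qed.

(** The generating function of B_k(t) is e^((1-t)x) phi(tx). *)
Lemma Bseq_cauchy_prod gamma k (t : R) : Defs.Bseq gamma k t / k`!%:R =
  cauchy_prod (fun j => (1 - t) ^+ j / j`!%:R)
    (fun j => t ^+ j * (gamma j / j`!%:R)) k.
Proof.
rewrite /Bseq /cauchy_prod mulr_suml; apply: eq_bigr => j _.
have le_jk : (j <= k)%N by rewrite -ltnS.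
rewrite -(bin_fact le_jk) !natrM; field.
by rewrite !pnatr_eq0 -!lt0n !fact_gt0 bin_gt0.
Qed.

Lemma Cseq_cauchy_prod gamma Gamma k (t s : R) :
  Cseq gamma Gamma k t s / k`!%:R =
  cauchy_prod (fun j => Defs.Bseq gamma j t / j`!%:R)
    (fun j => Defs.Bseq Gamma j s / j`!%:R) k.
Proof.
rewrite /Cseq /cauchy_prod mulr_suml; apply: eq_bigr => j _.
have le_jk : (j <= k)%N by rewrite -ltnS.
rewrite -(bin_fact le_jk) !natrM; field.
by rewrite !pnatr_eq0 -!lt0n !fact_gt0 bin_gt0.
Qed.

Lemma Bseq_limit gamma (t : R) : 0 <= t <= 1 ->
  hyperbolic_limit (fun k => gamma k / k`!%:R) ->
  hyperbolic_limit (fun k => Defs.Bseq gamma k t / k`!%:R).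
Proof.
move=> /andP[t0 t1] [[q qg stab_q]|g0]; [left | right=> k]; last first.
  by rewrite Bseq_cauchy_prod /cauchy_prod big1 // => j _; rewrite g0 !mulr0.
exists (fun n => exp_poly (1 - t) n * scale_poly t (q n)).
  have lim := coef_cvgM (@coef_cvg_exp (1 - t)) (@coef_cvg_scale t _ _ qg).
  apply: (coef_cvg_eq lim) => k.
  by rewrite Bseq_cauchy_prod.
move=> n; apply: rstabM; first by apply: rstab_exp_poly; rewrite subr_ge0.
exact: rstab_scale.
Qed.

End Approximation.

Theorem corollary29 (R : realType) (phi Phi : Cplx R -> Cplx R)
    (gamma Gamma : nat -> R)
    (hphi : LP_plus phi gamma) (hPhi : LP_plus Phi Gamma) (t s : R)
    (ht : 0 <= t <= 1) (hs : 0 <= s <= 1) :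
  multiplier_sequence (fun k => Cseq gamma Gamma k t s).
Proof.
have CE k : Cseq gamma Gamma k t s = Cseq gamma Gamma k t s / k`!%:R * k`!%:R.
  by rewrite divfK // pnatr_eq0 -lt0n fact_gt0.
under eq_fun => k do rewrite CE.
(* a zero factor phi or Phi gives the zero operator *)
have [[q qb stab_q]|b0] := Bseq_limit ht (LP_plus_limit hphi); last first.
  move=> p _; left; apply/polyP => k; rewrite coef_diag_op coef0.
  rewrite Cseq_cauchy_prod /cauchy_prod big1 ?mul0r // => j _.
  by rewrite b0 mul0r.
have [[Q Qb stab_Q]|b0] := Bseq_limit hs (LP_plus_limit hPhi); last first.
  move=> p _; left; apply/polyP => k; rewrite coef_diag_op coef0.
  rewrite Cseq_cauchy_prod /cauchy_prod big1 ?mul0r // => j _.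
  by rewrite b0 mulr0.
apply: (@hyperbolic_limit_multiplier _ (fun n => q n * Q n)).
  by apply: coef_cvg_eq (coef_cvgM qb Qb) _ => k; rewrite Cseq_cauchy_prod.
by move=> n; apply: rstabM.
Qed.
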